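(* Let $\{\widetilde\Gamma,\Gamma\}$ be any of the 16 pairs of Carter diagrams $(1)$–$(16)$ listed in the context, and let $\widetilde S$ be any $\widetilde\Gamma$-set in a simply-laced root system $\varPhi$. Let $\widetilde\alpha\in\widetilde S$ be the root singled out in the context for this pair, let $S(\widetilde\alpha)\subset\widetilde S$ be the subset listed there, and let $M_I$ be the linear map on the span of $\widetilde S$ listed there, i.e. $M_I\tau=\tau$ for every $\tau\in\widetilde S$ with $\tau\ne\widetilde\alpha$, and $M_I\widetilde\alpha=\alpha$ with $\alpha=-\widetilde\alpha+\sum t_i\tau_i$ (sum over $\tau_i\in\widetilde S$, $\tau_i\neq\widetilde\alpha$, $t_i\in\mathbb Z$) given by the listed formula. Then: (i) $\widetilde\alpha\in S(\widetilde\alpha)\subset\widetilde S$, the set $S(\widetilde\alpha)$ is a Dynkin subset of the listed type, and $\alpha$ is the minimal element of the root subsystem with base $S(\widetilde\alpha)$. The image $S=M_I\widetilde S=(\widetilde S\setminus\{\widetilde\alpha\})\sqcup\{\alpha\}$ satisfies the relations of the Carter diagram $\Gamma$, i.e. $S$ is a $\Gamma$-set up to similarity. (Thus $M_I$ is the transition matrix between $\widetilde S$ and $S$ regarded as bases of the same linear space.) (ii) $M_I$ is an involution on $\widetilde S\sqcup\{\alpha\}$: $M_I\widetilde\alpha=\alpha$ and $M_I\alpha=\widetilde\alpha$.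
   Context: $\varPhi$ is a simply-laced (type ADE) root system with inner product $(\cdot,\cdot)$ normalized so that $(\gamma,\gamma)=2$ for every root $\gamma$. A diagram is a finite graph each of whose edges is either solid or dotted. For a diagram $\Gamma$, a $\Gamma$-set is a set of linearly independent (not necessarily simple) roots of $\varPhi$, in bijection with the nodes of $\Gamma$ and denoted by the same symbols, such that for distinct nodes $x,y$: $(x,y)=0$ if $x,y$ are not joined, $(x,y)=-1$ if the edge $\{x,y\}$ is solid, $(x,y)=1$ if it is dotted. A similarity replaces one root $\tau$ of a set by $-\tau$; ''up to similarity'' means after finitely many similarities. A Dynkin subset is a subset of a $\widetilde\Gamma$-set which is a $\Gamma'$-set for a Dynkin diagram $\Gamma'$ (all edges solid); it is a base of a root subsystem of type $\Gamma'$, and the minimal element is the negative of the highest root of that subsystem with respect to this base. Carter diagrams (edge $\{x,y\}$ is written $xy$; all edges not listed as dotted are solid): $D_4$: $\alpha_2\alpha_1,\alpha_2\alpha_3,\alpha_2\alpha_4$. $D_4(a_1)$: solid $\alpha_2\alpha_1,\ \alpha_1\tilde\alpha_3,\ \alpha_2\alpha_4$; dotted $\tilde\alpha_3\alpha_4$. $D_l$ ($l\ge4$): $\tau_i\tau_{i+1}$ ($1\le i\le l-2$), and $\tau_2\beta_{k+1}$ (the last node is named $\beta_{k+1}$). $D_l(a_k)$ ($l\ge 4$, $1\le k\le[\frac{l-2}{2}]$): nodes $\tau_1,\dots,\tau_{l-1},\bar\tau_{k+1}$; solid $\tau_i\tau_{i+1}$ ($1\le i\le l-2$), $\tau_k\bar\tau_{k+1}$;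 dotted $\bar\tau_{k+1}\tau_{k+2}$. $E_6$: $\beta_1\alpha_1,\beta_1\alpha_2,\beta_1\alpha_3,\alpha_2\beta_2,\alpha_1\beta_3$. $E_6(a_1)$: solid $\beta_1\alpha_1,\beta_1\alpha_2,\beta_1\alpha_3,\alpha_2\beta_2,\alpha_3\tilde\beta_3$; dotted $\alpha_2\tilde\beta_3$. $E_6(a_2)$: solid $\beta_1\alpha_1,\beta_1\alpha_2,\beta_1\alpha_3,\alpha_3\tilde\beta_2,\alpha_3\tilde\beta_3$; dotted $\alpha_1\tilde\beta_2,\alpha_2\tilde\beta_3$. $E_7$: $\alpha_2\beta_1,\alpha_2\beta_2,\alpha_2\beta_3,\beta_2\alpha_3,\beta_1\alpha_1,\alpha_1\beta_4$. $E_7(a_1)$: solid $\alpha_2\beta_1,\alpha_2\beta_2,\alpha_2\beta_3,\beta_1\alpha_1,\alpha_1\beta_4,\beta_3\tilde\alpha_3$; dotted $\beta_1\tilde\alpha_3$. $E_7(a_2)$: solid $\alpha_2\beta_1,\alpha_2\beta_2,\alpha_2\beta_3,\beta_2\alpha_3,\beta_3\tilde\alpha_1,\tilde\alpha_1\beta_4$; dotted $\beta_2\tilde\alpha_1$. $E_7(a_3)$: solid $\alpha_2\beta_1,\alpha_2\beta_2,\alpha_2\beta_3,\beta_1\alpha_1,\beta_3\tilde\alpha_3,\beta_3\alpha_4$; dotted $\beta_1\tilde\alpha_3,\beta_2\alpha_4$. $E_7(a_4)$: solid $\beta_1\tilde\alpha_1,\beta_1\alpha_2,\beta_1\tilde\alpha_3,\alpha_2\beta_2,\alpha_2\beta_3,\beta_3\alpha_4$;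 dotted $\beta_2\tilde\alpha_1,\beta_3\tilde\alpha_3,\beta_2\alpha_4$. $E_8$: edges of $E_7$ and $\beta_4\alpha_4$. $E_8(a_1)$: edges of $E_7(a_1)$ and solid $\beta_4\alpha_4$. $E_8(a_2)$: edges of $E_7(a_2)$ and solid $\beta_4\alpha_4$. $E_8(a_3)$: solid $\tilde\alpha_1\beta_2,\tilde\alpha_1\beta_3,\tilde\alpha_1\beta_4,\beta_2\alpha_3,\beta_3\tilde\alpha_4,\alpha_2\beta_1,\alpha_2\beta_3$; dotted $\alpha_2\beta_2$. $E_8(a_4)$: solid $\alpha_2\beta_1,\alpha_2\beta_2,\alpha_2\beta_3,\beta_1\alpha_1,\alpha_1\beta_4,\beta_3\tilde\alpha_3,\beta_3\tilde\alpha_4$; dotted $\beta_1\tilde\alpha_3,\beta_2\tilde\alpha_4$. $E_8(a_5)$: solid $\alpha_2\beta_1,\alpha_2\beta_2,\alpha_2\beta_3,\beta_1\alpha_1,\beta_3\tilde\alpha_3,\beta_3\tilde\alpha_4,\tilde\alpha_4\tilde\beta_4$; dotted $\beta_1\tilde\alpha_3,\beta_2\tilde\alpha_4$. $E_8(a_6)$: solid $\alpha_2\beta_1,\alpha_2\beta_2,\alpha_2\beta_3,\beta_1\alpha_1,\alpha_1\tilde\beta_4,\tilde\beta_4\tilde\alpha_3,\beta_3\tilde\alpha_3,\beta_3\tilde\alpha_4$; dotted $\beta_1\tilde\alpha_3,\beta_2\tilde\alpha_4$. $E_8(a_7)$: solid $\beta_1\tilde\alpha_1,\beta_1\alpha_2,\beta_1\tilde\alpha_3,\alpha_2\beta_2,\alpha_2\beta_3,\beta_3\tilde\alpha_4,\tilde\alpha_4\tilde\beta_4$;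 dotted $\beta_2\tilde\alpha_1,\beta_3\tilde\alpha_3,\beta_2\tilde\alpha_4$. $E_8(a_8)$: solid $\tilde\alpha_4\beta_2,\tilde\alpha_4\beta_3,\tilde\alpha_4\beta_4,\beta_1\tilde\alpha_1,\beta_1\alpha_2,\beta_1\tilde\alpha_3,\beta_2\tilde\alpha_1,\beta_3\alpha_2,\beta_4\tilde\alpha_3$; dotted $\beta_2\alpha_2,\beta_3\tilde\alpha_3,\beta_4\tilde\alpha_1$. Pairs $\{\widetilde\Gamma,\Gamma\}$, with the formula for $M_I$ on the one root $\widetilde\alpha\in\widetilde S$ that is moved (all other roots of $\widetilde S$ are fixed; the image takes the role of the indicated node of $\Gamma$), and the type of $S(\widetilde\alpha)$; in each case $S(\widetilde\alpha)$ is the set of roots of $\widetilde S$ occurring in the formula: (1) $\{D_4(a_1),D_4\}$: $\tilde\alpha_3\mapsto\alpha_3=-(\alpha_1+\alpha_2+\tilde\alpha_3)$; $A_3$. (2) $\{D_l(a_k),D_l\}$: $\bar\tau_{k+1}\mapsto\beta_{k+1}=-(\tau_1+2\sum_{i=2}^k\tau_i+\tau_{k+1}+\bar\tau_{k+1})$ for $k\ge2$, type $D_{k+2}$; $\bar\tau_2\mapsto\beta_2=-(\tau_1+\tau_2+\bar\tau_2)$ for $k=1$, type $A_3$. (3) $\{E_6(a_1),E_6\}$: $\tilde\beta_3\mapsto\beta_3=-(\alpha_1+\beta_1+\alpha_3+\tilde\beta_3)$; $A_4$. (4) $\{E_6(a_2),E_6(a_1)\}$: $\tilde\beta_2\mapsto\beta_2=-(\alpha_3+\beta_1+\alpha_2+\tilde\beta_2)$;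 $A_4$. (5) $\{E_7(a_1),E_7\}$: $\tilde\alpha_3\mapsto\alpha_3=-(\beta_2+\alpha_2+\beta_3+\tilde\alpha_3)$; $A_4$. (6) $\{E_7(a_2),E_7\}$: $\tilde\alpha_1\mapsto\alpha_1=-(\beta_1+\alpha_2+\beta_3+\tilde\alpha_1)$; $A_4$. (7) $\{E_7(a_3),E_7(a_1)\}$: $\alpha_4\mapsto\beta_4=-(\alpha_4+\beta_3+\alpha_2+\beta_1+\alpha_1)$; $A_5$. (8) $\{E_7(a_4),E_7(a_3)\}$: $\tilde\alpha_1\mapsto\alpha_1=-(2\beta_1+\tilde\alpha_1+\alpha_2+\tilde\alpha_3)$; $D_4$. (9) $\{E_8(a_1),E_8\}$: $\tilde\alpha_3\mapsto\alpha_3=-(\tilde\alpha_3+\beta_3+\alpha_2+\beta_2)$; $A_4$. (10) $\{E_8(a_2),E_8\}$: $\tilde\alpha_1\mapsto\alpha_1=-(\tilde\alpha_1+\beta_3+\alpha_2+\beta_1)$; $A_4$. (11) $\{E_8(a_3),E_8(a_2)\}$: $\tilde\alpha_4\mapsto\alpha_4=-(3\tilde\alpha_1+2\beta_2+2\beta_3+2\beta_4+\alpha_3+\tilde\alpha_4)$; $E_6$. (12) $\{E_8(a_4),E_8(a_1)\}$: $\tilde\alpha_4\mapsto\alpha_4=-(\tilde\alpha_4+\beta_3+\alpha_2+\beta_1+\alpha_1+\beta_4)$; $A_6$. (13) $\{E_8(a_5),E_8(a_4)\}$: $\tilde\beta_4\mapsto\beta_4=-(\tilde\beta_4+\tilde\alpha_4+\beta_3+\alpha_2+\beta_1+\alpha_1)$;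 $A_6$. (14) $\{E_8(a_6),E_8(a_4)\}$: $\tilde\beta_4\mapsto\beta_4=-(\tilde\beta_4+2\alpha_1+2\beta_1+2\alpha_2+\beta_2+\beta_3)$; $D_6$. (15) $\{E_8(a_7),E_8(a_5)\}$: $\tilde\alpha_1\mapsto\alpha_1=-(2\beta_1+\tilde\alpha_1+\alpha_2+\tilde\alpha_3)$; $D_4$. (16) $\{E_8(a_8),E_8(a_7)\}$: $\beta_4\mapsto\tilde\beta_4=-(2\tilde\alpha_4+\beta_4+\beta_2+\beta_3)$; $D_4$. *)

(* Defs.v *)
From HB Require Import structures.
From mathcomp Require Import all_boot all_order all_algebra.

Set Implicit Arguments.
Unset Strict Implicit.
Unset Printing Implicit Defensive.

Import Order.TTheory GRing.Theory Num.Theory.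

Section RootSystems.
Local Open Scope ring_scope.
Variables (R : realFieldType) (V : vectType R) (form : {dot V for idfun}).

Definition reflection (b v : V) : V := v - (2 * form v b / form b b) *: b.

(* A reduced crystallographic root system in its own linear span; the ambient
   space V may be larger, so that the same predicate applies to root
   subsystems. *)
Definition root_system (Phi : seq V) : Prop :=
  [/\ 0 \notin Phi,
      {in Phi &, forall a b, reflection b a \in Phi},
      {in Phi &, forall a b, exists m : int,
         2 * form a b / form b b = m%:~R}
    & {in Phi, forall a (c : R), c *: a \in Phi -> c = 1 \/ c = -1}].

(* The normalization forces every Cartan integer between distinct,
   non-opposite roots to be 0, 1 or -1. *)
Definition simply_laced (Phi : seq V) : Prop := {in Phi, forall a, form a a = 2}.

Definition root_subsystem (Phi Psi : seq V) : Prop :=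
  {subset Psi <= Phi} /\ root_system Psi.

Definition nat_comb (B : seq V) (v : V) : Prop :=
  exists c : nat -> nat, v = \sum_(i < size B) B`_i *+ c i.

Definition is_base (B Psi : seq V) : Prop :=
  [/\ {subset B <= Psi}, free B
    & {in Psi, forall v, nat_comb B v \/ nat_comb B (- v)}].

Definition highest_root (B Psi : seq V) (h : V) : Prop :=
  h \in Psi /\ {in Psi, forall v, nat_comb B (h - v)}.

Definition minimal_element (Phi B : seq V) (a : V) : Prop :=
  exists Psi : seq V,
    [/\ root_subsystem Phi Psi, is_base B Psi & highest_root B Psi (- a)].

End RootSystems.

Inductive letter := Alpha | Beta | Tau.

Definition letter_code (x : letter) : nat :=
  match x with Alpha => 0 | Beta => 1 | Tau => 2 end.
Definition letter_decode (n : nat) : letter :=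
  match n with 0 => Alpha | 1 => Beta | _ => Tau end.
Lemma letter_codeK : cancel letter_code letter_decode.
Proof. by case. Qed.
HB.instance Definition _ := Equality.copy letter (can_type letter_codeK).

(* A letter, whether it carries a tilde (or a bar, for tau), and its index. *)
Definition node : Type := (letter * bool * nat)%type.

Definition al  (i : nat) : node := (Alpha, false, i).
Definition al' (i : nat) : node := (Alpha, true, i).
Definition be  (i : nat) : node := (Beta, false, i).
Definition be' (i : nat) : node := (Beta, true, i).
Definition ta  (i : nat) : node := (Tau, false, i).
Definition ta' (i : nat) : node := (Tau, true, i).

Record diagram := Diagram {
  nodes : seq node;
  solid : seq (node * node);
  dotted : seq (node * node) }.

Definition joined (E : seq (node * node)) (x y : node) : bool :=
  ((x, y) \in E) || ((y, x) \in E).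

Section DiagramSets.
Local Open Scope ring_scope.
Variables (R : realFieldType) (V : vectType R) (form : {dot V for idfun}).

Definition edge_product (G : diagram) (x y : node) : R :=
  if joined (solid G) x y then -1 else if joined (dotted G) x y then 1 else 0.

(* f names the roots by the nodes; freeness makes it injective on them. *)
Definition diagram_set (Phi : seq V) (G : diagram) (f : node -> V) : Prop :=
  [/\ {subset [seq f x | x <- nodes G] <= Phi},
      free [seq f x | x <- nodes G]
    & {in nodes G &, forall x y, x != y ->
         form (f x) (f y) = edge_product G x y}].

Definition similarity (x : node) (f : node -> V) : node -> V :=
  fun y => if y == x then - f y else f y.

Definition diagram_set_up_to_similarity (Phi : seq V) (G : diagram)
    (f : node -> V) : Prop :=
  exists2 s : seq node, {subset s <= nodes G}
    & diagram_set Phi G (foldr similarity f s).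

End DiagramSets.

Definition path_edges (n : nat) : seq (node * node) :=
  [seq (ta i, ta i.+1) | i <- iota 1 n.-1].

Definition A_diagram (n : nat) : diagram :=
  Diagram [seq ta i | i <- iota 1 n] (path_edges n) [::].

Definition D4 : diagram :=
  Diagram [:: al 1; al 2; al 3; al 4]
    [:: (al 2, al 1); (al 2, al 3); (al 2, al 4)] [::].

Definition D4a1 : diagram :=
  Diagram [:: al 1; al 2; al' 3; al 4]
    [:: (al 2, al 1); (al 1, al' 3); (al 2, al 4)]
    [:: (al' 3, al 4)].

(* D_l, where k only serves to name the last node. *)
Definition D_diagram (l k : nat) : diagram :=
  Diagram (rcons [seq ta i | i <- iota 1 l.-1] (be k.+1))
    (rcons (path_edges l.-1) (ta 2, be k.+1)) [::].

Definition D_a_diagram (l k : nat) : diagram :=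
  Diagram (rcons [seq ta i | i <- iota 1 l.-1] (ta' k.+1))
    (rcons (path_edges l.-1) (ta k, ta' k.+1))
    [:: (ta' k.+1, ta k.+2)].

Definition E6 : diagram :=
  Diagram [:: al 1; al 2; al 3; be 1; be 2; be 3]
    [:: (be 1, al 1); (be 1, al 2); (be 1, al 3); (al 2, be 2); (al 1, be 3)]
    [::].

Definition E6a1 : diagram :=
  Diagram [:: al 1; al 2; al 3; be 1; be 2; be' 3]
    [:: (be 1, al 1); (be 1, al 2); (be 1, al 3); (al 2, be 2); (al 3, be' 3)]
    [:: (al 2, be' 3)].

Definition E6a2 : diagram :=
  Diagram [:: al 1; al 2; al 3; be 1; be' 2; be' 3]
    [:: (be 1, al 1); (be 1, al 2); (be 1, al 3); (al 3, be' 2); (al 3, be' 3)]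
    [:: (al 1, be' 2); (al 2, be' 3)].

Definition E7 : diagram :=
  Diagram [:: al 1; al 2; al 3; be 1; be 2; be 3; be 4]
    [:: (al 2, be 1); (al 2, be 2); (al 2, be 3); (be 2, al 3); (be 1, al 1);
        (al 1, be 4)]
    [::].

Definition E7a1 : diagram :=
  Diagram [:: al 1; al 2; al' 3; be 1; be 2; be 3; be 4]
    [:: (al 2, be 1); (al 2, be 2); (al 2, be 3); (be 1, al 1); (al 1, be 4);
        (be 3, al' 3)]
    [:: (be 1, al' 3)].

Definition E7a2 : diagram :=
  Diagram [:: al' 1; al 2; al 3; be 1; be 2; be 3; be 4]
    [:: (al 2, be 1); (al 2, be 2); (al 2, be 3); (be 2, al 3); (be 3, al' 1);
        (al' 1, be 4)]
    [:: (be 2, al' 1)].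

Definition E7a3 : diagram :=
  Diagram [:: al 1; al 2; al' 3; al 4; be 1; be 2; be 3]
    [:: (al 2, be 1); (al 2, be 2); (al 2, be 3); (be 1, al 1); (be 3, al' 3);
        (be 3, al 4)]
    [:: (be 1, al' 3); (be 2, al 4)].

Definition E7a4 : diagram :=
  Diagram [:: al' 1; al 2; al' 3; al 4; be 1; be 2; be 3]
    [:: (be 1, al' 1); (be 1, al 2); (be 1, al' 3); (al 2, be 2); (al 2, be 3);
        (be 3, al 4)]
    [:: (be 2, al' 1); (be 3, al' 3); (be 2, al 4)].

Definition E8 : diagram :=
  Diagram (al 4 :: nodes E7) ((be 4, al 4) :: solid E7) [::].

Definition E8a1 : diagram :=
  Diagram (al 4 :: nodes E7a1) ((be 4, al 4) :: solid E7a1) (dotted E7a1).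

Definition E8a2 : diagram :=
  Diagram (al 4 :: nodes E7a2) ((be 4, al 4) :: solid E7a2) (dotted E7a2).

Definition E8a3 : diagram :=
  Diagram [:: al' 1; al 2; al 3; al' 4; be 1; be 2; be 3; be 4]
    [:: (al' 1, be 2); (al' 1, be 3); (al' 1, be 4); (be 2, al 3);
        (be 3, al' 4); (al 2, be 1); (al 2, be 3)]
    [:: (al 2, be 2)].

Definition E8a4 : diagram :=
  Diagram [:: al 1; al 2; al' 3; al' 4; be 1; be 2; be 3; be 4]
    [:: (al 2, be 1); (al 2, be 2); (al 2, be 3); (be 1, al 1); (al 1, be 4);
        (be 3, al' 3); (be 3, al' 4)]
    [:: (be 1, al' 3); (be 2, al' 4)].

Definition E8a5 : diagram :=
  Diagram [:: al 1; al 2; al' 3; al' 4; be 1; be 2; be 3; be' 4]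
    [:: (al 2, be 1); (al 2, be 2); (al 2, be 3); (be 1, al 1); (be 3, al' 3);
        (be 3, al' 4); (al' 4, be' 4)]
    [:: (be 1, al' 3); (be 2, al' 4)].

Definition E8a6 : diagram :=
  Diagram [:: al 1; al 2; al' 3; al' 4; be 1; be 2; be 3; be' 4]
    [:: (al 2, be 1); (al 2, be 2); (al 2, be 3); (be 1, al 1); (al 1, be' 4);
        (be' 4, al' 3); (be 3, al' 3); (be 3, al' 4)]
    [:: (be 1, al' 3); (be 2, al' 4)].

Definition E8a7 : diagram :=
  Diagram [:: al' 1; al 2; al' 3; al' 4; be 1; be 2; be 3; be' 4]
    [:: (be 1, al' 1); (be 1, al 2); (be 1, al' 3); (al 2, be 2); (al 2, be 3);
        (be 3, al' 4); (al' 4, be' 4)]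
    [:: (be 2, al' 1); (be 3, al' 3); (be 2, al' 4)].

Definition E8a8 : diagram :=
  Diagram [:: al' 1; al 2; al' 3; al' 4; be 1; be 2; be 3; be 4]
    [:: (al' 4, be 2); (al' 4, be 3); (al' 4, be 4); (be 1, al' 1);
        (be 1, al 2); (be 1, al' 3); (be 2, al' 1); (be 3, al 2);
        (be 4, al' 3)]
    [:: (be 2, al 2); (be 3, al' 3); (be 4, al' 1)].

(* TypeD n is meant for 4 <= n. *)
Inductive dynkin_type :=
  TypeA of nat | TypeD of nat | TypeE6 | TypeE7 | TypeE8.

Definition dynkin_diagram (t : dynkin_type) : diagram :=
  match t with
  | TypeA n => A_diagram n
  | TypeD n => D_diagram n 1
  | TypeE6 => E6
  | TypeE7 => E7
  | TypeE8 => E8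
  end.

(* formula = [:: (x_1, c_1); ...; (x_n, c_n)] stands for
   alpha = - (c_1 x_1 + ... + c_n x_n), where alpha, the image of the root
   named moved_node, takes the role of image_node in target. *)
Record transition := Transition {
  source : diagram;
  target : diagram;
  moved_node : node;
  image_node : node;
  formula : seq (node * nat);
  base_type : dynkin_type }.

Definition D_formula (k : nat) : seq (node * nat) :=
  if k == 1 then [:: (ta 1, 1); (ta 2, 1); (ta' 2, 1)]
  else (ta 1, 1) :: [seq (ta i, 2) | i <- iota 2 k.-1]
         ++ [:: (ta k.+1, 1); (ta' k.+1, 1)].

Definition D_type (k : nat) : dynkin_type :=
  if k == 1 then TypeA 3 else TypeD k.+2.

Inductive listed_transition : transition -> Prop :=
| listed_D4a1 : listed_transition
    (Transition D4a1 D4 (al' 3) (al 3)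
       [:: (al 1, 1); (al 2, 1); (al' 3, 1)] (TypeA 3))
| listed_D_a (l k : nat) : 4 <= l -> 1 <= k <= (l - 2)./2 -> listed_transition
    (Transition (D_a_diagram l k) (D_diagram l k) (ta' k.+1) (be k.+1)
       (D_formula k) (D_type k))
| listed_E6a1 : listed_transition
    (Transition E6a1 E6 (be' 3) (be 3)
       [:: (al 1, 1); (be 1, 1); (al 3, 1); (be' 3, 1)] (TypeA 4))
| listed_E6a2 : listed_transition
    (Transition E6a2 E6a1 (be' 2) (be 2)
       [:: (al 3, 1); (be 1, 1); (al 2, 1); (be' 2, 1)] (TypeA 4))
| listed_E7a1 : listed_transition
    (Transition E7a1 E7 (al' 3) (al 3)
       [:: (be 2, 1); (al 2, 1); (be 3, 1); (al' 3, 1)] (TypeA 4))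
| listed_E7a2 : listed_transition
    (Transition E7a2 E7 (al' 1) (al 1)
       [:: (be 1, 1); (al 2, 1); (be 3, 1); (al' 1, 1)] (TypeA 4))
| listed_E7a3 : listed_transition
    (Transition E7a3 E7a1 (al 4) (be 4)
       [:: (al 4, 1); (be 3, 1); (al 2, 1); (be 1, 1); (al 1, 1)] (TypeA 5))
| listed_E7a4 : listed_transition
    (Transition E7a4 E7a3 (al' 1) (al 1)
       [:: (be 1, 2); (al' 1, 1); (al 2, 1); (al' 3, 1)] (TypeD 4))
| listed_E8a1 : listed_transition
    (Transition E8a1 E8 (al' 3) (al 3)
       [:: (al' 3, 1); (be 3, 1); (al 2, 1); (be 2, 1)] (TypeA 4))
| listed_E8a2 : listed_transition
    (Transition E8a2 E8 (al' 1) (al 1)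
       [:: (al' 1, 1); (be 3, 1); (al 2, 1); (be 1, 1)] (TypeA 4))
| listed_E8a3 : listed_transition
    (Transition E8a3 E8a2 (al' 4) (al 4)
       [:: (al' 1, 3); (be 2, 2); (be 3, 2); (be 4, 2); (al 3, 1); (al' 4, 1)]
       TypeE6)
| listed_E8a4 : listed_transition
    (Transition E8a4 E8a1 (al' 4) (al 4)
       [:: (al' 4, 1); (be 3, 1); (al 2, 1); (be 1, 1); (al 1, 1); (be 4, 1)]
       (TypeA 6))
| listed_E8a5 : listed_transition
    (Transition E8a5 E8a4 (be' 4) (be 4)
       [:: (be' 4, 1); (al' 4, 1); (be 3, 1); (al 2, 1); (be 1, 1); (al 1, 1)]
       (TypeA 6))
| listed_E8a6 : listed_transition
    (Transition E8a6 E8a4 (be' 4) (be 4)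
       [:: (be' 4, 1); (al 1, 2); (be 1, 2); (al 2, 2); (be 2, 1); (be 3, 1)]
       (TypeD 6))
| listed_E8a7 : listed_transition
    (Transition E8a7 E8a5 (al' 1) (al 1)
       [:: (be 1, 2); (al' 1, 1); (al 2, 1); (al' 3, 1)] (TypeD 4))
| listed_E8a8 : listed_transition
    (Transition E8a8 E8a7 (be 4) (be' 4)
       [:: (al' 4, 2); (be 4, 1); (be 2, 1); (be 3, 1)] (TypeD 4)).

Section Transitions.
Local Open Scope ring_scope.
Variables (R : realFieldType) (V : vectType R) (form : {dot V for idfun}).
Variables (P : transition) (f : node -> V).

Definition source_set : (size (nodes (source P))).-tuple V :=
  map_tuple f (in_tuple (nodes (source P))).

Definition moved_root : V := f (moved_node P).

Definition image_root : V := - \sum_(p <- formula P) f p.1 *+ p.2.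

(* This is S(moved_root). *)
Definition base_roots : seq V := [seq f p.1 | p <- formula P].

Definition target_family (x : node) : V :=
  if x == image_node P then image_root else f x.

(* The action of an endomorphism of the subspace U on vectors of V that lie
   in U (it is not meaningful on other vectors). *)
Definition on_subspace (U : {vspace V}) (M : 'End(subvs_of U)) (v : V) : V :=
  vsval (M (vsproj U v)).

Definition transition_map (M : 'End(subvs_of <<source_set>>%VS)) : Prop :=
  {in source_set, forall v, v != moved_root -> on_subspace M v = v}
  /\ on_subspace M moved_root = image_root.

Definition image_set (M : 'End(subvs_of <<source_set>>%VS)) :
    (size (nodes (source P))).-tuple V :=
  map_tuple (on_subspace M) source_set.

Definition dynkin_subset (Phi : seq V) (t : dynkin_type) (B : seq V) : Prop :=
  exists2 h : node -> V, diagram_set form Phi (dynkin_diagram t) h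
    & [seq h x | x <- nodes (dynkin_diagram t)] =i B.

(* Columns hold the coordinates of the images, in the basis e, of its
   vectors. *)
Definition matrix_in (n : nat) (e : n.-tuple V) (F : V -> V) : 'M[R]_n :=
  \matrix_(i, j) coord e i (F e`_j).

Definition transition_matrix (n : nat) (e e' : n.-tuple V) (A : 'M[R]_n) : Prop :=
  forall j : 'I_n, e'`_j = \sum_i A i j *: e`_i.

End Transitions.

Local Open Scope ring_scope.

(* The transition map exists, so quantifying over it is not vacuous. *)
Lemma transition_map_exists (R : realFieldType) (V : vectType R)
    (P : transition) (f : node -> V) :
  moved_node P \in nodes (source P) ->
  {subset map fst (formula P) <= nodes (source P)} ->
  free (source_set P f) ->
  exists M : 'End(subvs_of <<source_set P f>>%VS), transition_map M.
Proof.
move=> mP sP frS; set U := (<<source_set P f>>)%VS.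
have inU x : x \in nodes (source P) -> f x \in U.
  by move=> xP; apply/memv_span/map_f.
have imU : image_root P f \in U.
  rewrite memvN big_seq; apply: memv_suml => p pP.
  by rewrite rpredMn // inU // sP // map_f.
pose h v := if v == moved_root P f then image_root P f else v.
have [g] := linear_of_free (source_set P f) [seq vsproj U (h v) | v <- source_set P f].
rewrite size_map => /(_ frS erefl) /eq_in_map gE.
exists (linfun (g \o vsval)).
have ME v : v \in source_set P f ->
    on_subspace (linfun (g \o vsval) : 'End(subvs_of U)) v = h v.
  move=> vS; rewrite /on_subspace lfunE /= vsprojK ?memv_span // gE //.
  by rewrite vsprojK // /h; case: ifP => // _; apply: memv_span.
split=> [v vS /negPf vm|]; first by rewrite ME // /h vm.
by rewrite ME ?/h ?eqxx //; apply/map_f.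
Qed.

(* Main.v *)
(* In a simply-laced root system every vector of norm 2 of the root lattice is a
   root. For an obtuse set B of independent roots this gives the subsystem of all
   roots in the integer span of B: B is a base of it, because two disjoint
   nonnegative combinations have nonpositive product, and a dominant vector of
   norm 2 whose coefficients are all positive is its highest root. So - alpha is a
   highest root, and alpha a root, as soon as finitely many integer products,
   computed from the edges of the source diagram, have the right values; the
   products of alpha with the other roots also give the target diagram. *)
Require Import Defs.
From mathcomp Require Import all_boot all_order all_algebra.
From mathcomp Require Import boolp ring lra zify.

Set Implicit Arguments.
Unset Strict Implicit.
Unset Printing Implicit Defensive.

Import Order.TTheory GRing.Theory Num.Theory.
Local Open Scope ring_scope.

(** * The root lattice *)

Section RootLattice.
Variables (R : realFieldType) (V : vectType R) (form : {dot V for idfun}).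

Lemma dotC u v : form u v = form v u.
Proof. by rewrite hermC expr0 mul1r. Qed.

Lemma dot_ge0 u : 0 <= form u u.
Proof.
by have [->|/neq0_dnorm_gt0/ltW //] := eqVneq u 0; rewrite linear0l.
Qed.

Lemma dot_eq0 u : form u u = 0 -> u = 0.
Proof.
move=> u0; apply/eqP; apply: contraT => /(neq0_dnorm_gt0 (s := form)).
by rewrite u0 ltxx.
Qed.

Lemma normB u v : form (u - v) (u - v) = form u u - 2 * form u v + form v v.
Proof. by rewrite linearBl !linearBr /= (dotC v u); ring. Qed.

Lemma dotMzl u v m : form (u *~ m) v = m%:~R * form u v.
Proof. by rewrite -scaler_int linearZl_LR. Qed.

Lemma dotMzr u v m : form u (v *~ m) = m%:~R * form u v.
Proof. by rewrite dotC dotMzl dotC. Qed.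

Variable Phi : seq V.
Hypotheses (rsPhi : root_system form Phi) (slPhi : simply_laced form Phi).

Lemma root_norm a : a \in Phi -> form a a = 2.
Proof. exact: slPhi. Qed.

Lemma cartan_intE a b : b \in Phi -> 2 * form a b / form b b = form a b.
Proof. by move=> /root_norm ->; field. Qed.

Lemma root_dot_int : {in Phi &, forall a b, exists m : int, form a b = m%:~R}.
Proof.
move=> a b aP bP; have [_ _ /(_ a b aP bP) [m]] := rsPhi.
by rewrite cartan_intE // => abm _; exists m.
Qed.

Lemma reflectionE a b : b \in Phi -> reflection form b a = a - form a b *: b.
Proof. by move=> bP; rewrite /reflection cartan_intE. Qed.

(** The reflection of [a] in itself is [- a]. *)
Lemma root_opp a : a \in Phi -> - a \in Phi.
Proof.
move=> aP; have [_ /(_ a a aP aP) + _ _] := rsPhi.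
by rewrite reflectionE // root_norm // scaler_nat mulr2n opprD addNKr.
Qed.

(** Roots are closed under negation, so sums without signs suffice; the number of summands is the
    induction measure of [root_lattice_norm2]. *)
Definition root_lattice (v : V) : Prop :=
  exists2 r : seq V, {subset r <= Phi} & v = \sum_(x <- r) x.

Lemma root_lattice_root a : a \in Phi -> root_lattice a.
Proof.
move=> aP; exists [:: a]; last by rewrite big_seq1.
by move=> x; rewrite inE => /eqP ->.
Qed.

Lemma root_lattice0 : root_lattice 0.
Proof. by exists [::]; rewrite ?big_nil. Qed.

Lemma root_latticeD u v :
  root_lattice u -> root_lattice v -> root_lattice (u + v).
Proof.
move=> [r rP ->] [s sP ->]; exists (r ++ s); last by rewrite big_cat.
by move=> x; rewrite mem_cat => /orP[/rP|/sP].
Qed.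

Lemma root_latticeN v : root_lattice v -> root_lattice (- v).
Proof.
move=> [r rP ->]; exists [seq - x | x <- r]; last by rewrite big_map sumrN.
by move=> _ /mapP[x /rP xP ->]; apply: root_opp.
Qed.

Lemma root_latticeMz v (m : int) : root_lattice v -> root_lattice (v *~ m).
Proof.
move=> vL; have nL n : root_lattice (v *+ n).
  by elim: n => [|n IHn]; [exact: root_lattice0 | rewrite mulrS; exact: root_latticeD].
case: m => n; first exact: nL.
by rewrite NegzE mulrNz; apply/root_latticeN/nL.
Qed.

Lemma root_lattice_sum (I : Type) (r : seq I) (F : I -> V) :
  (forall i, root_lattice (F i)) -> root_lattice (\sum_(i <- r) F i).
Proof.
by move=> FL; elim/big_rec: _ => [|i v _ vL];
  [exact: root_lattice0 | exact: root_latticeD].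
Qed.

Lemma root_lattice_dot_int a v :
  a \in Phi -> root_lattice v -> exists m : int, form v a = m%:~R.
Proof.
move=> aP [r rP ->]; elim: r rP => [|x r IHr] rP.
  by exists 0; rewrite big_nil linear0l.
have [|m mE] := IHr; first by move=> y yr; apply: rP; rewrite inE yr orbT.
have [k kE] := root_dot_int (rP _ (mem_head x r)) aP.
by exists (k + m); rewrite big_cons linearDl /= mE kE rmorphD.
Qed.

(** The norm of [x + w] exceeds that of [w] by [2 + 2 (w, x)], an even integer. *)
Lemma root_lattice_norm_even v :
  root_lattice v -> exists m : int, form v v = (2 * m)%:~R.
Proof.
move=> [r rP ->]; elim: r rP => [|x r IHr] rP.
  by exists 0; rewrite big_nil linear0l mulr0.
have rP' : {subset r <= Phi} by move=> y yr; apply: rP; rewrite inE yr orbT.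
have [m mE] := IHr rP'; have xP : x \in Phi by rewrite rP ?mem_head.
set w := \sum_(x <- r) x in mE *.
have [k kE] : exists k : int, form w x = k%:~R.
  by apply: root_lattice_dot_int xP _; exists r.
exists (1 + k + m); rewrite big_cons -/w linearDl !linearDr /= (dotC x w).
rewrite kE mE root_norm //; by rewrite !(rmorphD, rmorphM) /=; ring.
Qed.

Lemma root_lattice_norm_ge2 v : root_lattice v -> v != 0 -> 2 <= form v v.
Proof.
move=> /root_lattice_norm_even[m mE] /(neq0_dnorm_gt0 (s := form)).
rewrite mE ltr0z => m_gt0; rewrite (_ : 2 = 2%:~R :> R) // ler_int; lia.
Qed.

(* As (v, v) = 2 is the sum of the (v, x) over the summands x of v, some summand
   has (v, x) >= 1; either x = v, or v - x is a shorter sum of norm 2, and v is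
   its reflection in x. *)
Lemma root_lattice_norm2 v : root_lattice v -> form v v = 2 -> v \in Phi.
Proof.
move=> [r]; have [n] := ubnP (size r); elim: n => // n IHn in r v *.
rewrite ltnS => rn rP vE v2.
have [x xr vx] : exists2 x, x \in r & 0 < form v x.
  apply/hasP; apply: contraT => /hasPn rN.
  have: form v v <= 0.
    rewrite {2}vE linear_sumr big_seq; apply: sumr_le0 => x /rN.
    by rewrite -leNgt.
  by rewrite v2 leNgt ltr0n.
have xP := rP _ xr; have vL : root_lattice v by exists r.
have [m mE] := root_lattice_dot_int xP vL.
have := dot_ge0 (v - x); rewrite normB v2 root_norm // => vx0.
(* Here [0 <= |v - x|^2 = 4 - 2 m]; the extreme case [m = 2] forces [v = x]. *)
have m_le2 : m <= 2.
  by rewrite -(ler_int R) -mE; move: vx0; lra.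
move: vx; rewrite mE ltr0z => m_gt0.
have [m2|m1] : m = 2 \/ m = 1 by lia.
  suff -> : v = x by [].
  apply/eqP; rewrite -subr_eq0; apply/eqP/dot_eq0.
  by rewrite normB v2 root_norm // mE m2; ring.
rewrite m1 in mE; have yP : v - x \in Phi.
  apply: (IHn (rem x r)).
  - by rewrite size_rem // prednK //; case: (r) xr.
  - by move=> y /mem_rem /rP.
  - by rewrite vE (perm_big _ (perm_to_rem xr)) big_cons /= [x + _]addrC addrK.
  - by rewrite normB v2 root_norm // mE; ring.
have [_ /(_ _ _ yP xP) + _ _] := rsPhi.
rewrite reflectionE // linearBl /= mE root_norm //.
by rewrite (_ : _ - 2 = -1) ?scaleN1r ?opprK ?subrK //; ring.
Qed.

End RootLattice.

(** * Obtuse bases and highest roots *)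

Section ObtuseBase.
Variables (R : realFieldType) (V : vectType R) (form : {dot V for idfun}).
Variables (Phi B : seq V).
Hypotheses (rsPhi : root_system form Phi) (slPhi : simply_laced form Phi).
Hypotheses (BPhi : {subset B <= Phi}) (frB : free B).
Hypothesis obtuseB : {in B &, forall a b, a != b -> form a b <= 0}.

Definition int_comb (c : nat -> int) : V := \sum_(i < size B) B`_i *~ c i.

Lemma int_comb_nat (a : nat -> nat) :
  int_comb (fun i => (a i)%:Z) = \sum_(i < size B) B`_i *+ a i.
Proof. by []. Qed.

Lemma int_combB c d : int_comb c - int_comb d = int_comb (fun i => c i - d i).
Proof.
by rewrite /int_comb -sumrB; apply: eq_bigr => i _; rewrite mulrzBr.
Qed.

Lemma int_combMz c m : int_comb c *~ m = int_comb (fun i => c i * m).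
Proof.
rewrite /int_comb mulrz_suml; apply: eq_bigr => i _; by rewrite mulrzA.
Qed.

Lemma int_comb0 c : int_comb c = 0 -> forall i, (i < size B)%N -> c i = 0.
Proof.
move=> c0 i iB; have /freeP/(_ (fun j => (c j)%:~R)) frE : free (in_tuple B) by [].
have /frE/(_ (Ordinal iB))/eqP : \sum_(j < size B) (c j)%:~R *: (in_tuple B)`_j = 0.
  by rewrite -[RHS]c0; apply: eq_bigr => j _; rewrite scaler_int.
by rewrite intr_eq0 => /eqP.
Qed.

Lemma int_comb_inj c d : int_comb c = int_comb d ->
  forall i, (i < size B)%N -> c i = d i.
Proof.
move=> /eqP; rewrite -subr_eq0 int_combB => /eqP/int_comb0 cd i /cd/eqP.
by rewrite subr_eq0 => /eqP.
Qed.

Lemma int_comb_lattice c : root_lattice Phi (int_comb c).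
Proof.
rewrite /int_comb; apply: root_lattice_sum => i; apply: (root_latticeMz rsPhi slPhi).
by apply/root_lattice_root/BPhi/mem_nth.
Qed.

(** Equal indices contribute zero because one of the two coefficients vanishes; different indices
    name different roots, [B] being free, and these have nonpositive product. *)
Lemma nat_comb_disjoint_dot (a b : nat -> nat) :
  (forall i, a i = 0%N \/ b i = 0%N) ->
  form (\sum_(i < size B) B`_i *+ a i) (\sum_(i < size B) B`_i *+ b i) <= 0.
Proof.
move=> ab0; rewrite linear_sumlz; apply: sumr_le0 => i _.
rewrite linear_sumr; apply: sumr_le0 => j _ /=.
rewrite linearMnl linearMnr /= -mulrnA.
have [->|ij] := eqVneq i j.
  by case: (ab0 j) => ->; rewrite ?muln0 ?mul0n mulr0n.
rewrite mulrn_wle0 // obtuseB ?mem_nth // nth_uniq //; exact: free_uniq.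
Qed.

Definition pos_part (c : nat -> int) (i : nat) : nat := absz (Num.max (c i) 0).
Definition neg_part (c : nat -> int) (i : nat) : nat := absz (Num.max (- c i) 0).

Lemma int_comb_split c : int_comb c =
  \sum_(i < size B) B`_i *+ pos_part c i - \sum_(i < size B) B`_i *+ neg_part c i.
Proof.
rewrite -!int_comb_nat int_combB; apply: eq_bigr => i _; congr (_ *~ _).
rewrite /pos_part /neg_part; lia.
Qed.

Lemma pos_neg_disjoint c i : pos_part c i = 0%N \/ neg_part c i = 0%N.
Proof. rewrite /pos_part /neg_part; lia. Qed.

(* If v = p - n with p, n disjoint nonnegative combinations, then (p, n) <= 0, so
   p and n cannot both contribute at least 2 to (v, v) = 2. *)
Lemma norm2_int_comb_sign c : form (int_comb c) (int_comb c) = 2 ->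
  nat_comb B (int_comb c) \/ nat_comb B (- int_comb c).
Proof.
rewrite int_comb_split; have := nat_comb_disjoint_dot (pos_neg_disjoint c).
set p := \sum_(i < _) _; set n := \sum_(i < _) _ => pn0 pn2.
have [n0|n0] := eqVneq n 0; first by left; rewrite n0 subr0; eexists.
have [p0|p0] := eqVneq p 0; first by right; rewrite p0 sub0r opprK; eexists.
have pL : root_lattice Phi p by rewrite /p -int_comb_nat; apply: int_comb_lattice.
have nL : root_lattice Phi n by rewrite /n -int_comb_nat; apply: int_comb_lattice.
have := root_lattice_norm_ge2 rsPhi slPhi pL p0.
have := root_lattice_norm_ge2 rsPhi slPhi nL n0.
by move: pn2; rewrite normB; lra.
Qed.

(* Write h - v = p - n with disjoint nonnegative p, n, and let n <> 0. Dominance of h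
   and (p, n) <= 0 give |v - n|^2 <= 2 - |n|^2 <= 0, so v = n and h = p; but p has
   a zero coefficient wherever n does not. *)
Lemma dominant_full_norm2_highest (k : nat -> nat) v :
    (forall i, 0 < k i)%N -> (forall b, b \in B -> 0 <= form (int_comb k) b) ->
    form (int_comb k) (int_comb k) = 2 ->
    (exists c, v = int_comb c) -> form v v = 2 ->
  nat_comb B (int_comb k - v).
Proof.
move=> k_gt0; set h := int_comb k => hB h2 [c vE] v2.
have := nat_comb_disjoint_dot (pos_neg_disjoint (fun i => (k i)%:Z - c i)).
have := int_comb_split (fun i => (k i)%:Z - c i).
rewrite -int_combB -/h -vE.
set p := \sum_(i < _) _ => /=; set n := \sum_(i < _) _ => /= hvE pn0.
have [n0|n0] := eqVneq n 0; first by rewrite hvE n0 subr0; eexists.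
have nL : root_lattice Phi n by rewrite /n -int_comb_nat; apply: int_comb_lattice.
have n2 := root_lattice_norm_ge2 rsPhi slPhi nL n0.
have hn0 : 0 <= form h n.
  rewrite linear_sumr; apply: sumr_ge0 => i _.
  by rewrite linearMnr mulrn_wge0 // hB // mem_nth.
have vnE : form v n = form h n - form p n + form n n.
  rewrite -linearBl /= -linearDl /=; congr (form _ n).
  by rewrite -[LHS](subKr h) hvE opprB addrCA addrC.
have := dot_ge0 form (v - n); rewrite normB v2 vnE => vn0.
have /dot_eq0/eqP : form (v - n) (v - n) = 0.
  by apply: le_anti; rewrite dot_ge0 normB v2 vnE andbT; lra.
rewrite subr_eq0 => /eqP vn; move/eqP: hvE.
rewrite vn (inj_eq (addIr _)) /h /p -int_comb_nat => /eqP/int_comb_inj kE.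
have n_eq0 i : (i < size B)%N -> neg_part (fun i => (k i)%:Z - c i) i = 0%N.
  by move=> iB; move: (kE i iB) (k_gt0 i); rewrite /pos_part /neg_part; lia.
by case/eqP: n0; rewrite /n big1 // => i _; rewrite n_eq0.
Qed.

(** Classical logic turns the existence of coefficients into a boolean filter. *)
Definition spanned_roots : seq V := [seq v <- Phi | `[< exists c, v = int_comb c >]].

Lemma spanned_rootsP v :
  reflect (v \in Phi /\ exists c, v = int_comb c) (v \in spanned_roots).
Proof.
by rewrite mem_filter andbC; apply: (iffP andP) => -[-> /asboolP].
Qed.

(** Reflection in [b] subtracts an integer multiple of [b], hence stays in the integer span; the
    other axioms are inherited from [Phi]. *)
Lemma spanned_roots_subsystem : root_subsystem form Phi spanned_roots.
Proof.
have [Phi0 PhiR PhiZ Phi1] := rsPhi.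
have sP v : v \in spanned_roots -> v \in Phi by case/spanned_rootsP.
split=> //; split.
- by apply: contra Phi0 => /sP.
- move=> a b /spanned_rootsP[aP [c aE]] /spanned_rootsP[bP [d bE]].
  apply/spanned_rootsP; split; first exact: PhiR.
  have [m mE] := root_dot_int rsPhi slPhi aP bP.
  rewrite (reflectionE slPhi) // mE scaler_int aE bE int_combMz int_combB.
  by eexists.
- by move=> a b /sP aP /sP bP; apply: PhiZ.
- by move=> a /sP aP c /sP; apply: Phi1.
Qed.

Lemma spanned_roots_base : is_base B spanned_roots.
Proof.
split=> // [b bB|v /spanned_rootsP[/slPhi v2 [c vE]]]; last first.
  by rewrite vE; apply: norm2_int_comb_sign; rewrite -vE.
apply/spanned_rootsP; split; first exact: BPhi.
exists (fun i => (i == index b B)%:Z).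
have ib : (index b B < size B)%N by rewrite index_mem.
rewrite /int_comb (bigD1 (Ordinal ib)) //= eqxx nth_index // big1 ?addr0 // => i.
by rewrite -val_eqE /= => /negPf ->.
Qed.

Lemma dominant_full_norm2_minimal (k : nat -> nat) :
    (forall i, 0 < k i)%N -> (forall b, b \in B -> 0 <= form (int_comb k) b) ->
    form (int_comb k) (int_comb k) = 2 ->
  minimal_element form Phi B (- int_comb k).
Proof.
move=> k_gt0 kB k2; exists spanned_roots; split.
- exact: spanned_roots_subsystem.
- exact: spanned_roots_base.
rewrite opprK; split=> [|v /spanned_rootsP[/slPhi v2 vB]]; last first.
  exact: dominant_full_norm2_highest.
apply/spanned_rootsP; split; last by eexists.
exact: (root_lattice_norm2 rsPhi slPhi (int_comb_lattice _)).
Qed.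

End ObtuseBase.

(** * Transitions certified by integer computations *)

(** Integer twin of [edge_product], independent of [R], so that certificates can be evaluated. *)
Definition edge_int (G : diagram) (x y : node) : int :=
  if joined (solid G) x y then -1 else if joined (dotted G) x y then 1 else 0.

Definition gram (G : diagram) (x y : node) : int :=
  if x == y then 2 else edge_int G x y.

Definition sign (s : seq node) (x : node) : int := if x \in s then -1 else 1.

Definition others (P : transition) : seq node :=
  rem (moved_node P) (nodes (source P)).

(** [foldr] replaces [\sum] so that the value computes. *)
Definition height_dot (P : transition) (x : node) : int :=
  foldr +%R 0 [seq gram (source P) p.1 x *+ p.2 | p <- formula P].

Definition height_norm (P : transition) : int :=
  foldr +%R 0 [seq height_dot P p.1 *+ p.2 | p <- formula P].

(* With h = - alpha the combination of roots in the formula, [height_dot P x] is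
   (h, x) and [height_norm P] is (h, h). The map g labels S(moved_root) by the
   nodes of the Dynkin diagram, and s lists the roots of the image set to be
   negated in order to obtain a target set. *)
Record certificate (P : transition) (g : node -> node) (s : seq node) : Prop := {
  cert_uniq : uniq (nodes (source P));
  cert_sub : all (mem (nodes (source P))) (map fst (formula P));
  cert_uniq_formula : uniq (map fst (formula P));
  cert_moved : (moved_node P, 1%N) \in formula P;
  cert_coef : all (fun p => 0 < p.2)%N (formula P);
  cert_dominant : all (fun x => 0 <= height_dot P x) (map fst (formula P));
  cert_norm : height_norm P == 2;
  cert_label :
    perm_eq (map g (nodes (dynkin_diagram (base_type P)))) (map fst (formula P));
  cert_label_edges :
    all2rel (fun x y => (x != y) ==>
      (edge_int (dynkin_diagram (base_type P)) x y == gram (source P) (g x) (g y)))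
      (nodes (dynkin_diagram (base_type P)));
  cert_image : image_node P \notin nodes (source P);
  cert_target : perm_eq (nodes (target P)) (image_node P :: others P);
  cert_uniq_signs : uniq s;
  cert_signs : all (mem (others P)) s;
  cert_edges :
    all2rel (fun x y => (x != y) ==>
      (edge_int (target P) x y == sign s x * sign s y * edge_int (source P) x y))
      (others P);
  cert_image_edges :
    all (fun x => edge_int (target P) (image_node P) x == - sign s x * height_dot P x)
      (others P) }.

Lemma joinedC E x y : joined E x y = joined E y x.
Proof. by rewrite /joined orbC. Qed.

Lemma edge_intC G x y : edge_int G x y = edge_int G y x.
Proof. by rewrite /edge_int !(joinedC _ x). Qed.

Lemma edge_productE (R : realFieldType) G x y :
  edge_product R G x y = (edge_int G x y)%:~R.
Proof. by rewrite /edge_product /edge_int; do 2?case: ifP. Qed.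

Lemma dynkin_edge_le0 t x y : edge_int (dynkin_diagram t) x y <= 0.
Proof.
have dotted0 : dotted (dynkin_diagram t) = [::] by case: t.
by rewrite /edge_int dotted0 /joined /=; case: ifP.
Qed.

(** Without repetitions in [s], each of its nodes is negated exactly once. *)
Lemma foldr_similarity (R : realFieldType) (V : vectType R) (f : node -> V) s x :
  uniq s -> foldr (@similarity R V) f s x = f x *~ sign s x.
Proof.
rewrite /sign; elim: s => //= y s IHs /andP[ys us].
rewrite {1}/similarity inE; case: eqVneq ys => [<-|_] ys /=; last exact: IHs.
by rewrite IHs // (negPf ys) mulrNz.
Qed.

Lemma sub_free (R : realFieldType) (V : vectType R) (X Y : seq V) :
  free X -> uniq Y -> {subset Y <= X} -> free Y.
Proof.
move=> frX uY sYX; rewrite -(perm_free (_ : perm_eq [seq x <- X | x \in Y] Y)).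
  exact: filter_free.
apply: uniq_perm => // [|x]; first exact/filter_uniq/free_uniq.
by rewrite mem_filter; apply: andb_idr => /sYX.
Qed.

(** Signs change neither the span nor the number of vectors. *)
Lemma free_signed (R : realFieldType) (V : vectType R) (I : eqType) (F : I -> V)
    (e : I -> int) (r : seq I) :
    (forall i, e i = 1 \/ e i = -1) ->
  free [seq F i *~ e i | i <- r] = free [seq F i | i <- r].
Proof.
move=> e1; rewrite /free !size_map; congr (\dim _ == _).
apply: subv_anti; apply/andP; split; apply/span_subvP => _ /mapP[i ir ->].
  by rewrite rpredMz // memv_span // map_f.
have Fi : F i *~ e i \in <<[seq F i *~ e i | i <- r]>>%VS.
  by rewrite memv_span //; apply/mapP; exists i.
by case: (e1 i) Fi => ->; rewrite ?mulr1z // mulrN1z memvN.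
Qed.

(** * Consequences of a certificate: base, minimal element and target set *)

Section CertifiedTransition.
Variables (R : realFieldType) (V : vectType R) (form : {dot V for idfun}).
Variables (Phi : seq V) (P : transition) (f : node -> V).
Variables (g : node -> node) (s : seq node).
Hypotheses (rsPhi : root_system form Phi) (slPhi : simply_laced form Phi).
Hypothesis dsf : diagram_set form Phi (source P) f.
Hypothesis cert : certificate P g s.

Let N := nodes (source P).
Let alpha := image_root P f.
Let alpha_t := moved_root P f.
Let St := source_set P f.

Let rootf x : x \in N -> f x \in Phi.
Proof. by move=> xN; have [+ _ _] := dsf; apply; apply: map_f. Qed.

Let frSt : free St.
Proof. by have [] := dsf. Qed.

Let uniqN : uniq N := cert_uniq cert.

Lemma formula_nodes p : p \in formula P -> p.1 \in N.
Proof. by move=> pP; apply: (allP (cert_sub cert)); apply: map_f. Qed.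

Lemma moved_node_in : moved_node P \in N.
Proof. exact: formula_nodes (cert_moved cert). Qed.

Lemma mem_others x : (x \in others P) = (x != moved_node P) && (x \in N).
Proof. by rewrite mem_rem_uniq // inE. Qed.

Lemma image_notin_others : image_node P \notin others P.
Proof. by rewrite mem_others negb_and (cert_image cert) orbT. Qed.

Lemma perm_nodes : perm_eq N (moved_node P :: others P).
Proof. exact: perm_to_rem moved_node_in. Qed.

Lemma diagram_set_gram x y :
  x \in N -> y \in N -> form (f x) (f y) = (gram (source P) x y)%:~R.
Proof.
move=> xN yN; have [_ _ formE] := dsf; rewrite /gram.
case: eqVneq => [->|xy]; first exact/slPhi/rootf.
by rewrite formE // edge_productE.
Qed.

(** A common root would have product 2 with itself, while distinct nodes give -1, 0 or 1. *)
Lemma diagram_set_inj : {in N &, injective f}.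
Proof.
move=> x y xN yN fxy; apply/eqP; apply: contraT => xy.
have := diagram_set_gram xN yN; rewrite /gram fxy (negPf xy).
rewrite (slPhi (rootf yN)) (_ : 2 = 2%:~R :> R) // => /eqP; rewrite eqr_int.
by rewrite /edge_int; do 2?case: ifP.
Qed.

Definition height_root : V := \sum_(p <- formula P) f p.1 *+ p.2.

Lemma image_rootE : alpha = - height_root.
Proof. by []. Qed.

Lemma height_rootE x : x \in N -> form height_root (f x) = (height_dot P x)%:~R.
Proof.
move=> xN; rewrite linear_sumlz /height_dot foldrE big_map rmorph_sum /=.
rewrite !big_seq; apply: eq_bigr => p /formula_nodes pN.
by rewrite linearMnl /= diagram_set_gram // rmorphMn.
Qed.

Lemma height_root_norm : form height_root height_root = 2.
Proof.
rewrite -[RHS]/(2%:~R) -(eqP (cert_norm cert)) /height_norm foldrE big_map.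
rewrite {2}/height_root linear_sumr rmorph_sum /= !big_seq.
apply: eq_bigr => p /formula_nodes pN.
by rewrite linearMnr /= height_rootE // rmorphMn.
Qed.

Lemma base_roots_sub : {subset base_roots P f <= Phi}.
Proof. by move=> _ /mapP[p /formula_nodes pN ->]; apply: rootf. Qed.

Lemma base_roots_source : {subset base_roots P f <= St}.
Proof. by move=> _ /mapP[p /formula_nodes pN ->]; apply: map_f. Qed.

Lemma moved_root_base : alpha_t \in base_roots P f.
Proof. by apply/mapP; exists (moved_node P, 1%N); first exact: cert_moved cert. Qed.

Lemma free_base_roots : free (base_roots P f).
Proof.
apply: sub_free frSt _ base_roots_source.
rewrite /base_roots (map_comp f fst) map_inj_in_uniq ?(cert_uniq_formula cert) //.
move=> x y /(allP (cert_sub cert)) xN /(allP (cert_sub cert)) yN.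
exact: diagram_set_inj.
Qed.

Let D := dynkin_diagram (base_type P).

Lemma perm_label : perm_eq [seq f (g x) | x <- nodes D] (base_roots P f).
Proof.
by rewrite /base_roots (map_comp f g) (map_comp f fst) perm_map // (cert_label cert).
Qed.

Lemma label_nodes x : x \in nodes D -> g x \in N.
Proof.
move=> xD; apply: (allP (cert_sub cert)).
by rewrite -(perm_mem (cert_label cert)) map_f.
Qed.

Lemma label_dot : {in nodes D &, forall x y, x != y ->
  form (f (g x)) (f (g y)) = edge_product R D x y}.
Proof.
move=> x y xD yD xy; rewrite diagram_set_gram ?label_nodes // edge_productE.
by have /allrelP/(_ x y xD yD) := cert_label_edges cert; rewrite xy => /eqP ->.
Qed.

Lemma dynkin_base_roots : dynkin_subset form Phi (base_type P) (base_roots P f).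
Proof.
exists (f \o g); last by move=> v; rewrite -(perm_mem perm_label).
split; last exact: label_dot; last by rewrite (perm_free perm_label) free_base_roots.
by move=> v; rewrite (perm_mem perm_label); apply: base_roots_sub.
Qed.

(** The labelling reads these products off a Dynkin diagram, which has no dotted edge. *)
Lemma base_roots_obtuse : {in base_roots P f &, forall a b, a != b -> form a b <= 0}.
Proof.
move=> a b; rewrite -!(perm_mem perm_label) => /mapP[x xD ->] /mapP[y yD ->] ab.
rewrite label_dot // ?edge_productE ?lerz0 ?dynkin_edge_le0 //.
by apply: contraNneq ab => ->.
Qed.

(** The default coefficient 1 keeps [coef] positive past the end of the formula, since the
    highest-root criterion asks for positivity at every index. *)
Let coef i := (nth (moved_node P, 1%N) (formula P) i).2.

Lemma height_root_comb :
  height_root = int_comb (base_roots P f) (fun i => (coef i)%:Z).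
Proof.
rewrite int_comb_nat /height_root (big_nth (moved_node P, 1%N)) big_mkord size_map.
by apply: eq_bigr => i _; rewrite (nth_map (moved_node P, 1%N)).
Qed.

Lemma image_root_minimal : minimal_element form Phi (base_roots P f) alpha.
Proof.
rewrite image_rootE height_root_comb; apply: dominant_full_norm2_minimal => //.
- exact: base_roots_sub.
- exact: free_base_roots.
- exact: base_roots_obtuse.
- move=> i; have [iP|iP] := ltnP i (size (formula P)); last by rewrite /coef nth_default.
  by apply: (allP (cert_coef cert)); apply: mem_nth.
- rewrite -height_root_comb => _ /mapP[p pP ->]; rewrite height_rootE ?formula_nodes //.
  by rewrite ler0z; apply: (allP (cert_dominant cert)); apply: map_f.
- by rewrite -height_root_comb height_root_norm.
Qed.

Lemma height_root_in : height_root \in Phi.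
Proof.
apply: (root_lattice_norm2 rsPhi slPhi _ height_root_norm); rewrite height_root_comb.
exact: (int_comb_lattice rsPhi slPhi base_roots_sub).
Qed.

Lemma image_root_in : alpha \in Phi.
Proof. exact: (root_opp rsPhi slPhi height_root_in). Qed.

(** The summand of [- alpha] that the transition map fixes. The moved root has coefficient 1, so
    deleting its single pair removes it entirely. *)
Definition fixed_part : V := \sum_(p <- rem (moved_node P, 1%N) (formula P)) f p.1 *+ p.2.

Lemma image_root_fixed_part : alpha = - alpha_t - fixed_part.
Proof.
rewrite image_rootE /height_root (perm_big _ (perm_to_rem (cert_moved cert))).
by rewrite big_cons /= opprD.
Qed.

Lemma fixed_part_others p :
  p \in rem (moved_node P, 1%N) (formula P) -> p.1 \in others P.
Proof.
move=> pP; rewrite mem_others formula_nodes ?(mem_rem pP) // andbT.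
(* The nodes of the formula are distinct, so no second pair contains the moved node. *)
have := cert_uniq_formula cert.
rewrite (perm_uniq (perm_map fst (perm_to_rem (cert_moved cert)))) /=.
by case/andP=> + _; apply: contraNneq => {1}<-; exact: (map_f fst pP).
Qed.

Lemma fixed_part_span : fixed_part \in <<[seq f x | x <- others P]>>%VS.
Proof.
rewrite /fixed_part big_seq; apply: memv_suml => p /fixed_part_others pP.
by rewrite rpredMn // memv_span // map_f.
Qed.

Lemma perm_source : perm_eq St (alpha_t :: [seq f x | x <- others P]).
Proof. exact: (perm_map f perm_nodes). Qed.

(** The moved root is [- alpha - fixed_part]: were [alpha] in the span of the other roots, so would
    be the moved root, against freeness of the source set. *)
Lemma free_image : free (alpha :: [seq f x | x <- others P]).
Proof.
have := frSt; rewrite (perm_free perm_source) !free_cons => /andP[+ ->].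
rewrite andbT; apply: contra => aO; rewrite -memvN.
rewrite (_ : - alpha_t = alpha + fixed_part); last by rewrite image_root_fixed_part subrK.
by rewrite rpredD ?fixed_part_span.
Qed.

Lemma image_root_span : alpha \in <<St>>%VS.
Proof.
rewrite memvN big_seq; apply: memv_suml => p /formula_nodes pN.
by rewrite rpredMn // memv_span // map_f.
Qed.

Lemma image_root_notin_others : alpha \notin [seq f x | x <- others P].
Proof. by have /free_uniq/andP[] := free_image. Qed.

(** Equality would make the product of [height_root] with the moved root equal to -2, against
    dominance. *)
Lemma image_root_neq : alpha != alpha_t.
Proof.
apply/eqP => aE; have := height_rootE moved_node_in.
have -> : f (moved_node P) = - height_root by rewrite -image_rootE aE.
rewrite linearNr /= height_root_norm => h2.
have : 0 <= height_dot P (moved_node P).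
  apply: (allP (cert_dominant cert)).
  by apply/mapP; exists (moved_node P, 1%N); first exact: cert_moved cert.
by rewrite -(ler0z R) -h2; lra.
Qed.

Lemma image_root_notin : alpha \notin St.
Proof.
by rewrite (perm_mem perm_source) inE negb_or image_root_neq image_root_notin_others.
Qed.

Lemma mem_source_others v :
  (v \in [seq f x | x <- others P]) = (v != alpha_t) && (v \in St).
Proof.
rewrite (perm_mem perm_source) inE; case: eqVneq => //= ->.
by have := free_uniq frSt; rewrite (perm_uniq perm_source) => /andP[/negPf].
Qed.

Lemma target_family_others x : x \in others P -> target_family P f x = f x.
Proof.
by move=> xO; rewrite /target_family; case: eqP image_notin_others => // <-; rewrite xO.
Qed.

Lemma perm_target_family :
  perm_eq [seq target_family P f x | x <- nodes (target P)]
          (alpha :: [seq f x | x <- others P]).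
Proof.
apply: perm_trans (perm_map _ (cert_target cert)) _.
rewrite /= {1}/target_family eqxx perm_cons.
by have /eq_in_map -> := target_family_others.
Qed.

(** The similarities in [s] put signs on the remaining roots and leave [alpha] alone. Products of
    remaining roots come from the source edges, those with [alpha] from [height_dot]. *)
Lemma target_up_to_similarity :
  diagram_set_up_to_similarity form Phi (target P) (target_family P f).
Proof.
have memT x : (x \in nodes (target P)) = (x == image_node P) || (x \in others P).
  by rewrite (perm_mem (cert_target cert)) inE.
have sO x : x \in s -> x \in others P by move/(allP (cert_signs cert)).
exists s; first by move=> x /sO; rewrite memT orbC => ->.
pose F x := target_family P f x *~ sign s x.
have FE x : foldr (@similarity R V) (target_family P f) s x = F x.
  exact: foldr_similarity (cert_uniq_signs cert).
have sign_image : sign s (image_node P) = 1.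
  by rewrite /sign; case: ifP => // /sO; rewrite (negPf image_notin_others).
have F_image : F (image_node P) = alpha.
  by rewrite /F sign_image /target_family eqxx.
have F_others x : x \in others P -> F x = f x *~ sign s x.
  by move=> xO; rewrite /F target_family_others.
have othersN x : x \in others P -> x \in N by rewrite mem_others => /andP[].
have dot_image x : x \in others P ->
    form alpha (F x) = edge_product R (target P) (image_node P) x.
  move=> xO; rewrite F_others // edge_productE.
  rewrite (eqP (allP (cert_image_edges cert) _ xO)) dotMzr image_rootE linearNl /=.
  by rewrite height_rootE ?othersN // rmorphM rmorphN /=; ring.
split; rewrite ?(eq_map FE).
- move=> _ /mapP[x + ->]; rewrite memT => /orP[/eqP->|xO].
    by rewrite F_image image_root_in.
  have fxP := rootf (othersN x xO); rewrite F_others // /sign.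
  by case: ifP => _; rewrite ?mulrN1z ?(root_opp rsPhi slPhi).
- rewrite /F free_signed ?(perm_free perm_target_family) ?free_image //.
  by move=> x; rewrite /sign; case: ifP => _; [right | left].
move=> x y + + xy; rewrite !FE !memT => /orP[/eqP xI|xO] /orP[/eqP yI|yO].
- by rewrite xI yI eqxx in xy.
- by rewrite xI F_image dot_image.
- by rewrite yI F_image dotC dot_image // !edge_productE edge_intC.
rewrite !F_others // dotMzl dotMzr diagram_set_gram ?othersN //.
have /allrelP/(_ x y xO yO) := cert_edges cert.
rewrite /gram (negPf xy) edge_productE => /eqP ->.
by rewrite !rmorphM /=; ring.
Qed.

(** * The transition map as an involution and a change of basis *)

Section TransitionMap.
Variable M : 'End(subvs_of <<St>>%VS).
Hypothesis tmM : transition_map M.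
Let mu := on_subspace M.

Lemma on_subspace_moved : mu alpha_t = alpha.
Proof. by case: tmM. Qed.

Lemma on_subspace_others v : v \in [seq f x | x <- others P] -> mu v = v.
Proof. by rewrite mem_source_others => /andP[va vS]; have [fixM _] := tmM; exact: fixM. Qed.

Lemma on_subspace_fixed_part : mu fixed_part = fixed_part.
Proof.
(* [on_subspace] is a composite of linear maps starting on all of [V], so linearity needs no
   membership in the span. *)
rewrite /mu /on_subspace /fixed_part !linear_sum /= !big_seq.
apply: eq_bigr => p /fixed_part_others pO; rewrite !linearMn /=; congr (_ *+ _).
by apply: on_subspace_others; apply: map_f.
Qed.

(** With [q] the fixed part, [alpha = - alpha_t - q] is sent to [- alpha - q], which is
    [alpha_t]. *)
Lemma on_subspace_image : mu alpha = alpha_t.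
Proof.
have muE : mu alpha = - mu alpha_t - mu fixed_part.
  by rewrite image_root_fixed_part /mu /on_subspace !linearB /= !linearN.
rewrite muE on_subspace_moved on_subspace_fixed_part image_root_fixed_part.
by rewrite opprB opprK addrAC subrr add0r.
Qed.

Lemma perm_image_set : perm_eq (image_set M) (alpha :: [seq f x | x <- others P]).
Proof.
apply: perm_trans (perm_map mu perm_source) _; rewrite /= on_subspace_moved.
rewrite perm_cons map_id_in ?perm_refl //; exact: on_subspace_others.
Qed.

Lemma source_basis : basis_of <<St>> St.
Proof. by rewrite /basis_of eqxx. Qed.

Lemma image_basis : basis_of <<St>> (image_set M).
Proof.
rewrite basisEfree (perm_free perm_image_set) free_image size_tuple /=.
rewrite (eqnP frSt) size_tuple leqnn andbT; apply/span_subvP => v.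
rewrite (perm_mem perm_image_set) inE => /orP[/eqP->|]; first exact: image_root_span.
by rewrite mem_source_others => /andP[_]; apply: memv_span.
Qed.

Lemma image_transition_matrix :
  transition_matrix St (image_set M) (matrix_in St mu).
Proof.
move=> j; rewrite (nth_map 0) ?size_tuple //.
under eq_bigr do rewrite mxE; apply: coord_span.
(* Expansion in coordinates is valid only for vectors of the span, so the images must be shown to
   lie there. *)
have imM : {subset image_set M <= <<St>>%VS}.
  by have := image_basis; rewrite basisEfree => /and3P[_ /span_subvP].
by apply/imM/map_f/mem_nth; rewrite size_tuple.
Qed.

Lemma certified_transition :
  [/\ [/\ alpha_t \in base_roots P f,
          {subset base_roots P f <= St},
          dynkin_subset form Phi (base_type P) (base_roots P f)
        & minimal_element form Phi (base_roots P f) alpha],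
      [/\ image_set M =i [predU1 alpha & [predD1 St & alpha_t]],
          alpha \notin [predD1 St & alpha_t],
          image_set M =i [seq target_family P f x | x <- nodes (target P)]
        & diagram_set_up_to_similarity form Phi (target P) (target_family P f)]
    & [/\ basis_of <<St>> St, basis_of <<St>> (image_set M)
        & transition_matrix St (image_set M) (matrix_in St mu)]]
  /\ [/\ alpha \notin St,
         {in [predU1 alpha & St], forall v,
            mu v \in [predU1 alpha & St] /\ mu (mu v) = v},
         mu alpha_t = alpha
       & mu alpha = alpha_t].
Proof.
split; split.
- split; [exact: moved_root_base | exact: base_roots_source
         | exact: dynkin_base_roots | exact: image_root_minimal].
- split.
  + by move=> v; rewrite (perm_mem perm_image_set) !inE mem_source_others.
  + by rewrite inE negb_and image_root_notin orbT.
  + by move=> v; rewrite (perm_mem perm_image_set) (perm_mem perm_target_family).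
  + exact: target_up_to_similarity.
- split; [exact: source_basis | exact: image_basis | exact: image_transition_matrix].
- exact: image_root_notin.
- have aS : alpha_t \in St by apply: map_f moved_node_in.
  move=> v; rewrite !inE => /orP[/eqP->|vS].
    by rewrite on_subspace_image on_subspace_moved aS orbT.
  have [->|va] := eqVneq v alpha_t.
    by rewrite on_subspace_moved eqxx on_subspace_image.
  by rewrite !(@on_subspace_others v) ?mem_source_others ?va // vS orbT.
- exact: on_subspace_moved.
- exact: on_subspace_image.
Qed.

End TransitionMap.

End CertifiedTransition.

(** * The family D_l(a_k) *)

Lemma mem_path_edges n x y : ((x, y) \in path_edges n) =
  [&& x == ta x.2, y == ta y.2, (0 < x.2 < n)%N & y.2 == x.2.+1].
Proof.
apply/mapP/and4P => [[i + [-> ->]]|[/eqP -> /eqP -> /= xn /eqP ->]].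
  by rewrite mem_iota => iP; rewrite /= !eqxx; split=> //; lia.
by exists x.2; rewrite ?mem_iota //; case: x xn => /= _ i; lia.
Qed.

Lemma D_diagram_nodesP l k x :
  reflect ((exists2 i, (0 < i < l)%N & x = ta i) \/ x = be k.+1)
    (x \in nodes (D_diagram l k)).
Proof.
rewrite /= mem_rcons inE; apply: (iffP orP) => [[/eqP ->|/mapP[i + ->]]|[[i il ->]|->]].
- by right.
- by rewrite mem_iota => il; left; exists i => //; lia.
- by right; apply/map_f; rewrite mem_iota; lia.
- by left.
Qed.

Lemma D_a_diagram_nodesP l k x :
  reflect ((exists2 i, (0 < i < l)%N & x = ta i) \/ x = ta' k.+1)
    (x \in nodes (D_a_diagram l k)).
Proof.
rewrite /= mem_rcons inE; apply: (iffP orP) => [[/eqP ->|/mapP[i + ->]]|[[i il ->]|->]].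
- by right.
- by rewrite mem_iota => il; left; exists i => //; lia.
- by right; apply/map_f; rewrite mem_iota; lia.
- by left.
Qed.

Lemma uniq_tail_nodes l x :
  x \notin map ta (iota 1 l) -> uniq (rcons (map ta (iota 1 l)) x).
Proof.
by move=> xl; rewrite rcons_uniq xl map_inj_uniq ?iota_uniq // => i j [].
Qed.

Lemma ta_eq i j : (ta i == ta j) = (i == j).
Proof. by rewrite /ta xpair_eqE eqxx. Qed.

Lemma ta'_eq i j : (ta' i == ta' j) = (i == j).
Proof. by rewrite /ta' xpair_eqE eqxx. Qed.

Lemma be_eq i j : (be i == be j) = (i == j).
Proof. by rewrite /be xpair_eqE eqxx. Qed.

Lemma node_neq i j :
  ((ta i == be j) = false) * ((be i == ta j) = false) *
  ((ta i == ta' j) = false) * ((ta' i == ta j) = false) *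
  ((be i == ta' j) = false) * ((ta' i == be j) = false).
Proof. by []. Qed.

Definition nodeE := (ta_eq, ta'_eq, be_eq, node_neq).

(** Turns membership in the edge lists into conditions on indices, which [lia] decides. *)
Definition edgeE :=
  (mem_rcons, in_cons, in_nil, mem_path_edges, xpair_eqE, nodeE, eqxx, andbF, andFb, orbF).

Lemma D_edge_path l k i j : (0 < i < l)%N -> (0 < j < l)%N ->
  edge_int (D_diagram l k) (ta i) (ta j) = - ((i == j.+1) || (j == i.+1))%:Z.
Proof.
move=> il jl; rewrite /edge_int /joined /= !edgeE /=; do ?case: ifP; lia.
Qed.

Lemma D_edge_image l k j : edge_int (D_diagram l k) (be k.+1) (ta j) = - (j == 2)%:Z.
Proof. rewrite /edge_int /joined /= !edgeE /=; do ?case: ifP; lia. Qed.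

Lemma D_a_edge_path l k i j : (0 < i < l)%N -> (0 < j < l)%N ->
  edge_int (D_a_diagram l k) (ta i) (ta j) = - ((i == j.+1) || (j == i.+1))%:Z.
Proof.
move=> il jl; rewrite /edge_int /joined /= !edgeE /=; do ?case: ifP; lia.
Qed.

Lemma D_a_edge_bar l k j :
  edge_int (D_a_diagram l k) (ta' k.+1) (ta j) = (j == k.+2)%:Z - (j == k)%:Z.
Proof. rewrite /edge_int /joined /= !edgeE /=; do ?case: ifP; lia. Qed.

(** For [k = 1] the range of the coefficient 2 is empty, so one expression covers both cases of
    [D_formula]. *)
Definition D_coef (k i : nat) : nat := if (1 < i <= k)%N then 2 else 1.

Lemma D_formulaE k : (0 < k)%N -> D_formula k =
  rcons [seq (ta i, D_coef k i) | i <- iota 1 k.+1] (ta' k.+1, 1%N).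
Proof.
case: k => [//|[//|k]] _.
have -> : iota 1 k.+3 = 1%N :: rcons (iota 2 k.+1) k.+3.
  by rewrite -cats1 -[[:: k.+3]]/(iota (2 + k.+1) 1) -iotaD addn1.
rewrite map_cons map_rcons rcons_cons -!cats1 -catA {1 3}/D_coef !ltnn andbF.
congr (_ :: _ ++ _); apply/eq_in_map => i.
by rewrite mem_iota /D_coef => iP; rewrite ifT //; lia.
Qed.

Lemma sum_iota_delta n (F : nat -> int) a :
  \sum_(i <- iota 1 n) F i * (i == a)%:Z = if (0 < a <= n)%N then F a else 0.
Proof.
elim: n => [|n IHn]; first by rewrite big_nil; case: ifP => //; lia.
rewrite -[n.+1]addn1 iotaD big_cat big_seq1 /= IHn add1n.
have [<-|an] := eqVneq n.+1 a; first by rewrite mulr1; do 2?case: ifP; lia.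
by rewrite mulr0 addr0; congr (if _ then _ else _); lia.
Qed.

Section D_transition.
Variables l k : nat.
Hypotheses (k_gt0 : (0 < k)%N) (kl : (k.*2.+2 <= l)%N).

Let P := Transition (D_a_diagram l k) (D_diagram l k) (ta' k.+1) (be k.+1)
  (D_formula k) (D_type k).

Lemma D_height_dotE x : height_dot P x =
  \sum_(i <- iota 1 k.+1) (D_coef k i)%:Z * gram (D_a_diagram l k) (ta i) x
  + gram (D_a_diagram l k) (ta' k.+1) x.
Proof.
rewrite /height_dot /= D_formulaE // foldrE big_map -cats1 big_cat big_seq1 big_map /=.
by congr (_ + _); apply: eq_bigr => i _; rewrite -mulr_natl natz.
Qed.

(** Put [c_i = D_coef k i] for [1 <= i <= k + 1] and [c_i = 0] elsewhere. The path contributes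
    [2 c_j - c_(j-1) - c_(j+1)], which amounts to 1 at 2, 1 at [k] and -1 at [k + 2] (added up if
    [k = 2]). The barred root contributes -1 at [k] by its solid edge and 1 at [k + 2] by its dotted
    one, so only the value at 2 survives. *)
Lemma D_height_dot_path j : (0 < j < l)%N -> height_dot P (ta j) = (j == 2)%:Z.
Proof.
move=> jl; rewrite D_height_dotE.
(* For [j = 1] the index [j.-1] is 0, outside the range of summation, and the last sum vanishes. *)
have -> : \sum_(i <- iota 1 k.+1) (D_coef k i)%:Z * gram (D_a_diagram l k) (ta i) (ta j)
   = \sum_(i <- iota 1 k.+1) (D_coef k i)%:Z * (i == j)%:Z * 2
     - \sum_(i <- iota 1 k.+1) (D_coef k i)%:Z * (i == j.+1)%:Z
     - \sum_(i <- iota 1 k.+1) (D_coef k i)%:Z * (i == j.-1)%:Z.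
  rewrite -!sumrB !big_seq; apply: eq_bigr => i; rewrite mem_iota; move: i => /= i iP.
  rewrite /gram nodeE D_a_edge_path //; last lia.
  rewrite -mulrA -!mulrBr; congr (_ * _); case: eqP; lia.
rewrite -mulr_suml !sum_iota_delta /gram nodeE D_a_edge_bar /D_coef; do ?case: ifP => ?; lia.
Qed.

(** Among the path roots of the formula only [tau_k] meets the barred root, so the product is
    [2 - D_coef k k]. *)
Lemma D_height_dot_bar : height_dot P (ta' k.+1) = (k == 1)%:Z.
Proof.
rewrite D_height_dotE {2}/gram eqxx.
have -> : \sum_(i <- iota 1 k.+1) (D_coef k i)%:Z * gram (D_a_diagram l k) (ta i) (ta' k.+1)
   = - \sum_(i <- iota 1 k.+1) (D_coef k i)%:Z * (i == k)%:Z.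
  rewrite -sumrN !big_seq; apply: eq_bigr => i; rewrite mem_iota; move: i => /= i iP.
  rewrite /gram nodeE edge_intC D_a_edge_bar -mulrN; congr (_ * _); lia.
rewrite !sum_iota_delta /D_coef; do ?case: ifP => ?; lia.
Qed.

Lemma D_formula_nodes : map fst (D_formula k) = rcons (map ta (iota 1 k.+1)) (ta' k.+1).
Proof. by rewrite D_formulaE // map_rcons -map_comp. Qed.

(* For k >= 2 the Dynkin diagram branches at its second node, whereas the moved
   root is attached to tau_k; hence the reversal of the path. *)
Definition D_label (x : node) : node :=
  if k == 1 then nth x [:: ta 2; ta 1; ta' 2] (index x [:: ta 1; ta 2; ta 3])
  else if x == be 2 then ta' k.+1 else ta (k.+2 - x.2).

Lemma D_perm_label :
  perm_eq (map D_label (nodes (dynkin_diagram (D_type k)))) (map fst (D_formula k)).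
Proof.
rewrite D_formula_nodes /D_label /D_type; have [-> //|k1] := eqVneq k 1.
rewrite -[nodes _]/(rcons (map ta (iota 1 k.+1)) (be 2)).
rewrite map_rcons eqxx -!cats1 perm_cat2r -map_comp.
apply: uniq_perm => [||x].
- rewrite map_inj_in_uniq ?iota_uniq // => i j; rewrite !mem_iota => iP jP.
  by rewrite /= ?nodeE => -[]; lia.
- by rewrite map_inj_uniq ?iota_uniq // => i j [].
(* Reversal of the indices is its own inverse, so both inclusions have the same witness. *)
apply/mapP/mapP => -[i]; rewrite mem_iota => iP ->; exists (k.+2 - i)%N.
- by rewrite mem_iota; lia.
- by [].
- by rewrite mem_iota; lia.
- by rewrite /=; congr ta; lia.
Qed.

(** For [k = 1] the path of type [A_3] has [tau_1] in the middle, between [tau_2] and the barred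
    root. In all cases the path labels stop at [tau_(k+1)], so the dotted edge to [tau_(k+2)] never
    enters. *)
Lemma D_label_edges :
  all2rel (fun x y => (x != y) ==>
    (edge_int (dynkin_diagram (D_type k)) x y
     == gram (D_a_diagram l k) (D_label x) (D_label y)))
    (nodes (dynkin_diagram (D_type k))).
Proof.
rewrite /D_label /D_type; have [k1|k1] := eqVneq k 1.
  have l4 : (4 <= l)%N by lia.
  rewrite k1; apply/allrelP => x y.
  rewrite !inE => /or3P[]/eqP-> /or3P[]/eqP-> //=; rewrite /gram ?nodeE /=
    ?(edge_intC _ (ta _) (ta' _)) ?D_a_edge_bar ?D_a_edge_path //; lia.
apply/allrelP => x y /D_diagram_nodesP[[i iP ->]|->] /D_diagram_nodesP[[j jP ->]|->];
  apply/implyP; rewrite /gram /= ?eqxx ?nodeE //= => ij; apply/eqP.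
- rewrite D_edge_path // D_a_edge_path; try lia.
  by rewrite ifF; lia.
- by rewrite edge_intC D_edge_image edge_intC D_a_edge_bar; lia.
- by rewrite D_edge_image D_a_edge_bar; lia.
Qed.

(** No signs are needed: the remaining roots form the whole path, joined alike in both diagrams. *)
Lemma D_certificate : certificate P D_label [::].
Proof.
have height_ge0 x : x \in nodes (D_a_diagram l k) -> 0 <= height_dot P x.
  by case/D_a_diagram_nodesP => [[j jl ->]|->];
    rewrite ?D_height_dot_path ?D_height_dot_bar.
have memF : {subset map fst (D_formula k) <= nodes (D_a_diagram l k)}.
  move=> x; rewrite D_formula_nodes mem_rcons inE => /orP[/eqP ->|/mapP[i + ->]].
    by apply/D_a_diagram_nodesP; right.
  by rewrite mem_iota => iP; apply/D_a_diagram_nodesP; left; exists i => //; lia.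
have bar_notin n : ta' k.+1 \notin map ta (iota 1 n) by apply/mapP => -[].
have be_notin n : be k.+1 \notin map ta (iota 1 n) by apply/mapP => -[].
have othersE : others P = map ta (iota 1 l.-1).
  rewrite /others rem_filter ?uniq_tail_nodes //= filter_rcons /= eqxx.
  by apply/all_filterP/allP => x xP; apply: contraNneq (bar_notin l.-1) => <-.
have othersP x : x \in others P -> exists2 i, (0 < i < l)%N & x = ta i.
  by rewrite othersE => /mapP[i + ->]; rewrite mem_iota => iP; exists i => //; lia.
split=> //=.
- exact: uniq_tail_nodes.
- exact/allP.
- by rewrite D_formula_nodes uniq_tail_nodes.
- by rewrite D_formulaE // mem_rcons mem_head.
- rewrite D_formulaE // all_rcons /=; apply/allP => _ /mapP[i _ ->] /=.
  by rewrite /D_coef; case: ifP.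
- by apply/allP => x /memF; apply: height_ge0.
- rewrite /height_norm /= D_formulaE // foldrE big_map -cats1 big_cat big_seq1 big_map /=.
  rewrite D_height_dot_bar.
  have -> : \sum_(i <- iota 1 k.+1) height_dot P (ta i) *+ D_coef k i
     = \sum_(i <- iota 1 k.+1) (D_coef k i)%:Z * (i == 2)%:Z.
    rewrite !big_seq; apply: eq_bigr => i; rewrite mem_iota; move: i => /= i iP.
    have il : (0 < i < l)%N by lia.
    by rewrite D_height_dot_path // pmulrn mulrzz mulrC.
  (* The norm is [1 + 1] for [k = 1] and [2 + 0] for larger [k]. *)
  by rewrite sum_iota_delta /D_coef; do ?case: ifP => ?; lia.
- exact: D_perm_label.
- exact: D_label_edges.
- by rewrite mem_rcons inE negb_or be_notin.
- by rewrite othersE -cats1 perm_catC.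
- apply/allrelP => x y /othersP[i iP ->] /othersP[j jP ->].
  by rewrite D_edge_path // D_a_edge_path // !mul1r eqxx implybT.
- apply/allP => x /othersP[i iP ->].
  by rewrite D_edge_image D_height_dot_path // mulN1r.
Qed.

End D_transition.

(** * Explicit certificates for the sixteen pairs *)

Definition labelling (t : dynkin_type) (r : seq node) (x : node) : node :=
  nth x r (index x (nodes (dynkin_diagram t))).

(** Outside the family D_l(a_k) the diagrams are closed data and evaluation decides every condition.
    Labels are listed in the order of the nodes of the Dynkin diagram. *)
Lemma listed_certificate P :
  listed_transition P -> exists g s, certificate P g s.
Proof.
case.
- exists (labelling (TypeA 3) [:: al 2; al 1; al' 3]), [::].
  by split; vm_compute.
- move=> l k _ /andP[k_gt0 kl]; exists (D_label k), [::].
  by apply: D_certificate => //; lia.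
- exists (labelling (TypeA 4) [:: al 1; be 1; al 3; be' 3]), [::].
  by split; vm_compute.
- exists (labelling (TypeA 4) [:: al 2; be 1; al 3; be' 2]), [::].
  by split; vm_compute.
- exists (labelling (TypeA 4) [:: be 2; al 2; be 3; al' 3]), [::].
  by split; vm_compute.
(* The product of [alpha] with [be 4] is 1, whereas the target edge is solid. *)
- exists (labelling (TypeA 4) [:: be 1; al 2; be 3; al' 1]), [:: be 4].
  by split; vm_compute.
- exists (labelling (TypeA 5) [:: al 4; be 3; al 2; be 1; al 1]), [::].
  by split; vm_compute.
(* [al' 3] has a solid edge to [be 1] and a dotted one to [be 3]; the target exchanges the two
   kinds. *)
- exists (labelling (TypeD 4) [:: al' 1; be 1; al 2; al' 3]), [:: al' 3].
  by split; vm_compute.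
- exists (labelling (TypeA 4) [:: al' 3; be 3; al 2; be 2]), [::].
  by split; vm_compute.
(* [be 4] is negated because its product with [alpha] is 1, and [al 4] to keep their common edge
   solid. *)
- exists (labelling (TypeA 4) [:: al' 1; be 3; al 2; be 1]), [:: al 4; be 4].
  by split; vm_compute.
(* [be 2] has a dotted edge to [al 2] and a solid one to [al' 1], exchanged in the target; negating
   [al 3] too keeps its edge to [be 2] solid. *)
- exists (labelling TypeE6 [:: be 2; be 3; be 4; al' 1; al' 4; al 3]), [:: al 3; be 2].
  by split; vm_compute.
- exists (labelling (TypeA 6) [:: al' 4; be 3; al 2; be 1; al 1; be 4]), [::].
  by split; vm_compute.
- exists (labelling (TypeA 6) [:: be' 4; al' 4; be 3; al 2; be 1; al 1]), [::].
  by split; vm_compute.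
- exists (labelling (TypeD 6) [:: be 2; al 2; be 1; al 1; be' 4; be 3]), [::].
  by split; vm_compute.
- exists (labelling (TypeD 4) [:: al' 1; be 1; al 2; al' 3]), [:: al' 3].
  by split; vm_compute.
(* All three edges at [be 2] change kind from source to target. *)
- exists (labelling (TypeD 4) [:: be 4; al' 4; be 2; be 3]), [:: be 2].
  by split; vm_compute.
Qed.

Theorem theorem4p1 (R : realFieldType) (V : vectType R)
    (form : {dot V for idfun}) (Phi : seq V)
    (P : transition) (f : node -> V)
    (M : 'End(subvs_of <<source_set P f>>%VS)) :
  root_system form Phi -> simply_laced form Phi ->
  listed_transition P ->
  diagram_set form Phi (source P) f ->
  transition_map M ->
  let St := source_set P f in
  let S := image_set M in
  let alpha_t := moved_root P f in
  let alpha := image_root P f in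
  (* (i) *)
  [/\ [/\ alpha_t \in base_roots P f,
          {subset base_roots P f <= St},
          dynkin_subset form Phi (base_type P) (base_roots P f)
        & minimal_element form Phi (base_roots P f) alpha],
      [/\ S =i [predU1 alpha & [predD1 St & alpha_t]],
          alpha \notin [predD1 St & alpha_t],
          S =i [seq target_family P f x | x <- nodes (target P)]
        & diagram_set_up_to_similarity form Phi (target P) (target_family P f)]
    & [/\ basis_of <<St>> St, basis_of <<St>> S
        & transition_matrix St S (matrix_in St (on_subspace M))]]
  (* (ii) *)
  /\ [/\ alpha \notin St,
         {in [predU1 alpha & St], forall v,
            on_subspace M v \in [predU1 alpha & St]
            /\ on_subspace M (on_subspace M v) = v},
         on_subspace M alpha_t = alpha
       & on_subspace M alpha = alpha_t].
Proof.
move=> rsPhi slPhi /listed_certificate[g [s cert]] dsf tmM.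
exact: (certified_transition rsPhi slPhi dsf cert tmM).
Qed.
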